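(* Let $K$ be a finite field. Then the theory $T_K$ is incomplete, $T_K$ does not eliminate quantifiers in $L_K$, and the theory $T_{K,\infty}$ does not eliminate quantifiers in $L_K$ either.
   Context: Let $K$ be a finite field. Let $L_{K\text{-vs}} = \{+,0,\lambda\cdot \mid \lambda\in K\}$ be the language of $K$-vector spaces, and let $L_K$ be $L_{K\text{-vs}}$ together with unary predicates $X^n$ for $n\in\omega$; write $X := X^1$. The $L_K$-theory $T_K$ is axiomatised as follows. (1) The reduct to $L_{K\text{-vs}}$ is a $K$-vector space. (2) $X$ is closed under multiplication by every $\lambda\in K$. (3) Each $X^n$ is interpreted as the $n$-fold sum $\{x_0+\dots+x_{n-1}\mid x_j\in X\}$, with the convention $X^0=\{0\}$. (4) The parallelism relation $x\parallel y :\Leftrightarrow x+y\in X$ is an equivalence relation on $X\setminus\{0\}$; the union of an equivalence class with $\{0\}$ is called an axis (each axis is a subspace). (5) There are infinitely many axes. (6) The axes are linearly independent: if $Y_0,\dots,Y_n$ are pairwise distinct axes and $a_i\in Y_i\setminus\{0\}$, then $a_0,\dots,a_n$ are linearly independent. The theory $T_{K,\infty}$ is $T_K$ together with the axioms stating that every axis is infinite-dimensional. *)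

(* Defs.v *)
From mathcomp Require Import all_boot all_order all_algebra.

Set Implicit Arguments.
Unset Strict Implicit.
Unset Printing Implicit Defensive.

Local Open Scope ring_scope.

(** * First-order logic over the language L_K *)

Inductive term (K : Type) : Type :=
| TVar (n : nat)
| TZero
| TAdd (t u : term K)
| TScale (a : K) (t : term K).

Arguments TVar {K} n.
Arguments TZero {K}.

(* [FX n t] is the atomic formula X^n(t). *)
Inductive formula (K : Type) : Type :=
| FTrue
| FEq (t u : term K)
| FX (n : nat) (t : term K)
| FNot (f : formula K)
| FAnd (f g : formula K)
| FOr (f g : formula K)
| FImp (f g : formula K)
| FAll (n : nat) (f : formula K)
| FEx (n : nat) (f : formula K).

Arguments FTrue {K}.

Definition FIff K (f g : formula K) : formula K := FAnd (FImp f g) (FImp g f).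

Fixpoint tvars K (t : term K) : seq nat :=
  match t with
  | TVar n => [:: n]
  | TZero => [::]
  | TAdd t u => tvars t ++ tvars u
  | TScale _ t => tvars t
  end.

Fixpoint fvars K (f : formula K) : seq nat :=
  match f with
  | FTrue => [::]
  | FEq t u => tvars t ++ tvars u
  | FX _ t => tvars t
  | FNot f => fvars f
  | FAnd f g | FOr f g | FImp f g => fvars f ++ fvars g
  | FAll n f | FEx n f => [seq m <- fvars f | m != n]
  end.

Definition sentence K (f : formula K) : Prop := fvars f = [::].

Fixpoint quantifier_free K (f : formula K) : bool :=
  match f with
  | FTrue | FEq _ _ | FX _ _ => true
  | FNot f => quantifier_free f
  | FAnd f g | FOr f g | FImp f g => quantifier_free f && quantifier_free g
  | FAll _ _ | FEx _ _ => false
  end.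

(* An arbitrary L_K-structure: no axioms are imposed on the symbols. *)
Record structure (K : Type) : Type := Structure {
  carrier :> Type;
  s_zero : carrier;
  s_add : carrier -> carrier -> carrier;
  s_scale : K -> carrier -> carrier;
  s_X : nat -> carrier -> Prop
}.

Definition upd (T : Type) (e : nat -> T) (n : nat) (x : T) : nat -> T :=
  fun m => if m == n then x else e m.

Fixpoint eval K (M : structure K) (e : nat -> M) (t : term K) : M :=
  match t with
  | TVar n => e n
  | TZero => s_zero M
  | TAdd t u => s_add (eval e t) (eval e u)
  | TScale a t => s_scale a (eval e t)
  end.

Fixpoint holds K (M : structure K) (e : nat -> M) (f : formula K) : Prop :=
  match f with
  | FTrue => True
  | FEq t u => eval e t = eval e u
  | FX n t => s_X n (eval e t)
  | FNot f => ~ holds e f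
  | FAnd f g => holds e f /\ holds e g
  | FOr f g => holds e f \/ holds e g
  | FImp f g => holds e f -> holds e g
  | FAll n f => forall x : M, holds (upd e n x) f
  | FEx n f => exists x : M, holds (upd e n x) f
  end.

Definition theory (K : Type) : Type := formula K -> Prop.

Definition model K (T : theory K) (M : structure K) : Prop :=
  forall f, T f -> forall e : nat -> M, holds e f.

Definition entails K (T : theory K) (f : formula K) : Prop :=
  forall M : structure K, model T M -> forall e : nat -> M, holds e f.

Definition complete K (T : theory K) : Prop :=
  forall f, sentence f -> entails T f \/ entails T (FNot f).

Definition eliminates_quantifiers K (T : theory K) : Prop :=
  forall f : formula K, exists g : formula K,
    [/\ quantifier_free g, {subset fvars g <= fvars f} & entails T (FIff f g)].

(** * The theories T_K and T_{K,oo} *)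

(* Quantifier blocks over the variables 0, ..., n - 1. *)
Definition FAlls K (n : nat) (f : formula K) : formula K :=
  foldr (@FAll K) f (iota 0 n).
Definition FExs K (n : nat) (f : formula K) : formula K :=
  foldr (@FEx K) f (iota 0 n).

(* t is in X \ {0} *)
Definition FX0 K (t : term K) : formula K := FAnd (FX 1 t) (FNot (FEq t TZero)).

Definition FPar K (t u : term K) : formula K := FX 1 (TAdd t u).

(* For u in X \ {0}: t lies in the axis of u. *)
Definition FInAxis K (t u : term K) : formula K :=
  FOr (FEq t TZero) (FAnd (FX0 t) (FPar t u)).

(* The variables 0, ..., n - 1 are nonzero elements of pairwise distinct axes,
   two elements of X \ {0} lying in the same axis iff they are parallel. *)
Definition FDistinctAxes K (n : nat) : formula K :=
  FAnd (\big[@FAnd K/FTrue]_(i < n) FX0 (TVar i))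
       (\big[@FAnd K/FTrue]_(i < n) \big[@FAnd K/FTrue]_(j < n | i != j)
           FNot (FPar (TVar i) (TVar j))).

Section Theories.
Variable K : finFieldType.

Local Notation "''v_' n" := (@TVar K n) (at level 8, n at level 2).
Local Notation "t '+t' u" := (@TAdd K t u) (at level 50, left associativity).
Local Notation "a '*t' t" := (@TScale K a t) (at level 40).
Local Notation "t '=t' u" := (@FEq K t u) (at level 70).

(* Linear independence of the variables 0, ..., n - 1 is a single formula
   because K is finite. *)
Definition FIndep (n : nat) : formula K :=
  \big[@FAnd K/FTrue]_(c : {ffun 'I_n -> K} | [exists i, c i != 0])
     FNot (\big[@TAdd K/TZero]_(i < n) (c i *t 'v_i) =t TZero).

Inductive TK : theory K :=
| TK_addA : TK (FAlls 3 ('v_0 +t ('v_1 +t 'v_2) =t ('v_0 +t 'v_1) +t 'v_2))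
| TK_addC : TK (FAlls 2 ('v_0 +t 'v_1 =t 'v_1 +t 'v_0))
| TK_add0 : TK (FAlls 1 (TZero +t 'v_0 =t 'v_0))
| TK_addN : TK (FAll 0 (FEx 1 ('v_0 +t 'v_1 =t TZero)))
| TK_scaleA (a b : K) : TK (FAlls 1 (a *t (b *t 'v_0) =t (a * b) *t 'v_0))
| TK_scale1 : TK (FAlls 1 (1 *t 'v_0 =t 'v_0))
| TK_scaleDr (a : K) :
    TK (FAlls 2 (a *t ('v_0 +t 'v_1) =t a *t 'v_0 +t a *t 'v_1))
| TK_scaleDl (a b : K) :
    TK (FAlls 1 ((a + b) *t 'v_0 =t a *t 'v_0 +t b *t 'v_0))
| TK_X_scale (a : K) : TK (FAlls 1 (FImp (FX 1 'v_0) (FX 1 (a *t 'v_0))))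
| TK_X_sum (n : nat) :
    TK (FAll n (FIff (FX n 'v_n)
      (FExs n (FAnd (\big[@FAnd K/FTrue]_(i < n) FX 1 'v_i)
                    ('v_n =t \big[@TAdd K/TZero]_(i < n) 'v_i)))))
| TK_par_refl : TK (FAlls 1 (FImp (FX0 'v_0) (FPar 'v_0 'v_0)))
| TK_par_sym :
    TK (FAlls 2 (FImp (FAnd (FX0 'v_0) (FX0 'v_1))
      (FImp (FPar 'v_0 'v_1) (FPar 'v_1 'v_0))))
| TK_par_trans :
    TK (FAlls 3 (FImp (FAnd (FX0 'v_0) (FAnd (FX0 'v_1) (FX0 'v_2)))
      (FImp (FPar 'v_0 'v_1) (FImp (FPar 'v_1 'v_2) (FPar 'v_0 'v_2)))))
| TK_axes_infinite (n : nat) : TK (FExs n (FDistinctAxes K n))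
| TK_axes_indep (n : nat) :
    TK (FAlls n (FImp (FDistinctAxes K n) (FIndep n))).

(* Every axis contains n linearly independent elements; the axis is that of
   the variable n. *)
Definition FAxisDim (n : nat) : formula K :=
  FAll n (FImp (FX0 'v_n)
    (FExs n (FAnd (\big[@FAnd K/FTrue]_(i < n) FInAxis 'v_i 'v_n) (FIndep n)))).

Definition TKinf : theory K := fun f => TK f \/ exists n, f = FAxisDim n.

End Theories.

Arguments TK : clear implicits.
Arguments TKinf : clear implicits.

(* Main.v *)
Require Import Defs.
From mathcomp Require Import all_boot all_order all_algebra.
From Stdlib Require Import Setoid FunctionalExtensionality.

Set Implicit Arguments.
Unset Strict Implicit.
Unset Printing Implicit Defensive.

Import GRing.Theory.
Local Open Scope ring_scope.

(** All models used here have one shape: for a nonzero K-space Y, the K-space of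
    all sequences of vectors of Y, where X^n holds of the sequences with at
    most n nonzero coordinates (called rows). The axes are the copies of Y at
    the various rows, so [row_structure Y] is a model of T_K
    ([row_structure_TK]), and of T_{K,oo} when Y = K[t] ([row_poly_TKinf]).

    Incompleteness: the sentence saying that every axis contains two linearly
    independent vectors holds for Y = K[t] and fails for Y = K. It also refutes
    elimination for T_K: at the zero assignment all terms denote 0 and 0 lies in
    every X^n, so all models agree on quantifier-free formulas there.

    For T_{K,oo}, put q = |K|. An atomic formula about a pair (a, b) only sees
    the weights, that is the numbers of nonzero rows, of the combinations
    l a + m b. In K[t]-sequences with rows indexed by the projective line
    K + {oo}, let a be 1 on K and 0 at oo, and take two choices for b:
    - b is c at row c and 1 at oo, so that row by row (a, b) runs through the
      points of the projective line; a nonzero combination is a nonzero linear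
      form and vanishes at exactly one point;
    - b is t on K and 0 at oo, so that a and b are linearly independent at each
      row of K; a nonzero combination vanishes exactly at oo.
    In both cases all nonzero combinations have weight q, whence the pairs
    satisfy the same quantifier-free formulas ([pairs_qf_agree]). But in the
    first pair the row c = 0 carries a part of a and nothing of b, while in the
    second every row meeting a meets b. So the first pair only admits x in X
    such that a - x has weight q - 1 and b - x has weight more than q
    ([pt_FPeel], [gen_FPeel]). *)

(** * Semantics of iterated connectives and quantifiers *)

Lemma holds_bigand K (M : structure K) (e : nat -> M) (I : finType)
    (P : pred I) (F : I -> formula K) :
  holds e (\big[@FAnd K/FTrue]_(i | P i) F i) <->
  forall i, P i -> holds e (F i).
Proof.
suff H (s : seq I) : holds e (\big[@FAnd K/FTrue]_(i <- s | P i) F i) <->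
    forall i, i \in s -> P i -> holds e (F i).
  rewrite H; split=> h i; last by move=> _; apply: h.
  by apply: h; rewrite mem_index_enum.
elim: s => [|j s IHs]; first by rewrite big_nil.
rewrite big_cons; case: ifP => Pj /=; rewrite IHs; split.
- by move=> [hj hs] i; rewrite inE => /predU1P[-> //|]; apply: hs.
- move=> h; split=> [|i si]; first by apply: h => //; rewrite mem_head.
  by apply: h; rewrite inE si orbT.
- move=> hs i; rewrite inE => /predU1P[->|]; first by rewrite Pj.
  exact: hs.
- by move=> h i si; apply: h; rewrite inE si orbT.
Qed.

Lemma eq_holds K (M : structure K) (e e' : nat -> M) (f : formula K) :
  e =1 e' -> holds e f -> holds e' f.
Proof. by move=> ee'; rewrite (functional_extensionality _ _ ee'). Qed.

Lemma holds_foldr_FEx K (M : structure K) (f : formula K) (s : seq nat)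
    (e : nat -> M) :
  holds e (foldr (@FEx K) f s) <->
  exists x : nat -> M, holds (fun m => if m \in s then x m else e m) f.
Proof.
elim: s e => [|a s IHs] e /=.
  by split=> [h|[x]//]; exists e.
split=> [[y /IHs[x h]]|[x h]].
  exists (fun m => if m \in s then x m else y).
  apply: (eq_holds _ h) => m.
  by rewrite inE /upd; case: (m \in s); rewrite ?orbT ?orbF.
exists (x a); apply/IHs; exists x.
apply: (eq_holds _ h) => m.
by rewrite inE /upd; case: eqP => [->|_] /=; rewrite ?if_same.
Qed.

Lemma holds_foldr_FAll K (M : structure K) (f : formula K) (s : seq nat)
    (e : nat -> M) :
  (forall e' : nat -> M, holds e' f) -> holds e (foldr (@FAll K) f s).
Proof. by move=> h; elim: s e => [|a s IHs] e //= x; apply: IHs. Qed.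

Lemma fvars_foldr_FEx K (f : formula K) (s : seq nat) m :
  (m \in fvars (foldr (@FEx K) f s)) = (m \in fvars f) && (m \notin s).
Proof.
elim: s => [|a s IHs] /=; first by rewrite andbT.
by rewrite mem_filter IHs inE negb_or andbCA.
Qed.

Lemma all_fvars_bigand K (p : pred nat) (I : finType) (P : pred I)
    (F : I -> formula K) :
  (forall i, P i -> all p (fvars (F i))) ->
  all p (fvars (\big[@FAnd K/FTrue]_(i | P i) F i)).
Proof.
move=> h; elim/big_ind: _ => //= f g hf hg.
by rewrite all_cat hf.
Qed.

Lemma all_tvars_bigadd K (p : pred nat) (I : finType) (F : I -> term K) :
  (forall i, all p (tvars (F i))) ->
  all p (tvars (\big[@TAdd K/TZero]_i F i)).
Proof.
move=> h; elim/big_ind: _ => //= t u ht hu.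
by rewrite all_cat ht.
Qed.

(** The variables of the body are at most n; the block FExs binds those below n
    and the outer quantifier binds n. *)
Lemma sentence_FAxisDim (K : finFieldType) n : sentence (FAxisDim K n).
Proof.
rewrite /sentence /= eqxx /=; set r := (X in filter _ X).
suff : ~~ has (fun m => m != n) r by rewrite has_filter negbK => /eqP.
rewrite -all_predC; apply/allP => m /=; rewrite negbK.
rewrite fvars_foldr_FEx mem_iota leq0n add0n /= -leqNgt => /andP[mf nm].
suff /allP/(_ m mf) : all (leq^~ n) (fvars (FAnd
    (\big[@FAnd K/FTrue]_(i < n) FInAxis (TVar i) (TVar n)) (FIndep K n))).
  by move=> mn; rewrite eqn_leq mn.
rewrite /= all_cat; apply/andP; split; apply: all_fvars_bigand => i _ /=.
  by rewrite leqnn !(ltnW (ltn_ord i)).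
rewrite cats0; apply: all_tvars_bigadd => j /=.
by rewrite (ltnW (ltn_ord j)).
Qed.

(** * Quantifier-free formulas and elimination *)

Lemma qf_agree K (M N : structure K) (e : nat -> M) (e' : nat -> N) :
  (forall t u, eval e t = eval e u <-> eval e' t = eval e' u) ->
  (forall n t, s_X n (eval e t) <-> s_X n (eval e' t)) ->
  forall f, quantifier_free f -> (holds e f <-> holds e' f).
Proof.
move=> hE hX; elim=> //=.
- by move=> f IHf /IHf ->.
- by move=> f IHf g IHg /andP[/IHf -> /IHg ->].
- by move=> f IHf g IHg /andP[/IHf -> /IHg ->].
- by move=> f IHf g IHg /andP[/IHf -> /IHg ->].
Qed.

(** The assignments may live in two different models, so this serves both for
    one structure with two tuples and for two structures. *)
Lemma not_eliminates_quantifiers K (T : theory K) (M N : structure K)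
    (e : nat -> M) (e' : nat -> N) (f : formula K) :
  model T M -> model T N ->
  (forall g, quantifier_free g -> (holds e g <-> holds e' g)) ->
  holds e f -> ~ holds e' f -> ~ eliminates_quantifiers T.
Proof.
move=> TM TN agree ef e'f /(_ f)[g [qf_g _ fg]].
have [fg_M _] := fg M TM e; have [_ gf_N] := fg N TN e'.
by apply: e'f; apply: gf_N; apply/(agree g qf_g)/fg_M.
Qed.

(** * Sequences of vectors, with the coordinate subspaces as axes *)

(** X^n is defined by a bound on the support instead of as an n-fold sum, so
    that weights can be read off directly; [holds_X_sum] recovers the sum. *)
Definition row_structure (K : finFieldType) (Y : lmodType K) : structure K :=
  @Structure K (nat -> Y) (fun=> 0) (fun u v k => u k + v k)
    (fun a v k => a *: v k)
    (fun n v => exists2 s : seq nat,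
       (size s <= n)%N & forall k, k \notin s -> v k = 0).

Section RowStructure.
Variables (K : finFieldType) (Y : lmodType K).
Local Notation M := (row_structure Y).
Implicit Types (u v : M) (e : nat -> M).

Definition on_row (r : nat) v := forall k, k != r -> v k = 0.

Lemma X1P v : s_X 1 v <-> exists r, on_row r v.
Proof.
split=> [[[|r [|//]] _ h]|[r h]].
- by exists 0%N => k _; apply: h.
- by exists r => k kr; apply: h; rewrite inE.
- by exists [:: r] => // k; rewrite inE; apply: h.
Qed.

Lemma X0_row v :
  s_X 1 v -> v <> s_zero M -> exists2 r, v r != 0 & on_row r v.
Proof.
move=> /X1P[r h] nz; exists r => //; apply/eqP => v0; apply: nz.
apply: functional_extensionality => k.
by have [->|/h] := eqVneq k r.
Qed.

(** If r and r' differ, then u + v has two nonzero rows and is not in X. *)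
Lemma par_row u v r r' : u r != 0 -> on_row r u -> v r' != 0 -> on_row r' v ->
  s_X 1 (s_add u v) <-> r = r'.
Proof.
move=> ur hu vr' hv; split=> [/X1P[k h]|err']; last first.
  apply/X1P; exists r => k kr /=.
  by rewrite (hu k kr) (hv k) ?addr0 // -err'.
apply/eqP/contraT => rr'.
have [kr|kr] := eqVneq r k.
  have r'r : r' != r by rewrite eq_sym.
  have /eqP : s_add u v r' = 0 by apply: h; rewrite -kr.
  by rewrite /= (hu r' r'r) add0r (negPf vr').
by have /eqP := h r kr; rewrite /= (hv r rr') addr0 (negPf ur).
Qed.

Lemma X_ge_size n v (s : seq nat) :
  uniq s -> (forall k, k \in s -> v k != 0) -> s_X n v -> (size s <= n)%N.
Proof.
move=> us hs [s' le_n h]; apply: leq_trans le_n; apply: uniq_leq_size => // k.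
by move=> /hs; apply: contraNT => /h/eqP.
Qed.

Lemma eval_bigadd e (I : finType) (F : I -> term K) k :
  eval e (\big[@TAdd K/TZero]_i F i) k = \sum_i (eval e (F i) : M) k.
Proof. exact: (big_morph (fun t => (eval e t : M) k)). Qed.

Lemma holds_X_sum e n : holds e (FAll n (FIff (FX n (TVar n))
  (FExs n (FAnd (\big[@FAnd K/FTrue]_(i < n) FX 1 (TVar i))
     (FEq (TVar n) (\big[@TAdd K/TZero]_(i < n) TVar i)))))).
Proof.
move=> x; split.
  rewrite /= {1}/upd eqxx => -[s le_n h]; apply/holds_foldr_FEx.
  (* The i-th summand is the part of x at the rows whose first occurrence in s
     is at position i. Rows outside s have index size s, which may be smaller
     than n, but x vanishes there. *)
  exists (fun i k => if i == index k s then x k else 0); split.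
    apply/holds_bigand => i _ /=; rewrite mem_iota /= add0n ltn_ord.
    apply/X1P; exists (nth 0 s i) => k kr; case: eqP => // ik.
    by apply: h; apply: contra kr => ks; rewrite ik nth_index.
  rewrite /= mem_iota ltnn /= /upd eqxx.
  apply: functional_extensionality => k; rewrite eval_bigadd /=.
  under eq_bigr => i _ do rewrite mem_iota /= add0n ltn_ord.
  have [ks|/[dup] /h -> kNs] := boolP (k \in s); last first.
    by rewrite big1 // => i _; rewrite if_same.
  have kn : (index k s < n)%N by apply: leq_trans le_n; rewrite index_mem.
  rewrite (bigD1 (Ordinal kn)) //= eqxx big1 ?addr0 // => i.
  by rewrite -val_eqE /= => /negPf ->.
move=> /holds_foldr_FEx[y [/holds_bigand hX]] /=.
rewrite mem_iota ltnn /= /upd eqxx => ->.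
have {}hX (i : 'I_n) : exists r, on_row r (y i).
  by apply/X1P; have := hX i isT; rewrite /= mem_iota /= add0n ltn_ord.
have [s] : exists2 s : seq nat, (size s <= n)%N &
    forall (i : 'I_n) k, k \notin s -> (y i : M) k = 0.
  have [r hr] := fin_all_exists hX.
  exists (codom r); first by rewrite size_codom card_ord.
  move=> i k ks; apply: hr; apply: contra ks => /eqP ->.
  exact: codom_f.
move=> ss hs; exists s => // k ks; rewrite eval_bigadd big1 // => i _.
by rewrite /= mem_iota /= add0n ltn_ord hs.
Qed.

Lemma holds_axes_infinite (y : Y) e n :
  y != 0 -> holds e (FExs n (FDistinctAxes K n)).
Proof.
move=> y0; apply/holds_foldr_FEx.
pose x r : M := fun k => if k == r then y else 0; exists x.
have xr r : x r r != 0 by rewrite /x eqxx.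
have hx r : on_row r (x r) by rewrite /x => k /negPf ->.
split.
  apply/holds_bigand => i _ /=; rewrite mem_iota /= add0n ltn_ord.
  split; first by apply/X1P; exists (i : nat).
  by move=> h; have := xr i; rewrite h eqxx.
apply/holds_bigand => i _; apply/holds_bigand => j ij /=.
rewrite !mem_iota /= !add0n !ltn_ord.
move=> /(par_row (xr i) (hx i) (xr j) (hx j)) /val_inj eij.
by rewrite eij eqxx in ij.
Qed.

(** Evaluating a linear relation at the row of the i0-th vector kills all
    other terms, hence the i0-th coefficient is zero. *)
Lemma holds_axes_indep e n :
  holds e (FImp (FDistinctAxes K n) (FIndep K n)).
Proof.
move=> [/holds_bigand hX /holds_bigand hP].
apply/holds_bigand => c /existsP[i0 ci0] /= sum0.
have row (i : 'I_n) : exists2 r, (e i : M) r != 0 & on_row r (e i).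
  by have [] := hX i isT; apply: X0_row.
have [r er hr] := row i0.
have := congr1 (fun v : M => v r) sum0.
rewrite eval_bigadd (bigD1 i0) //= big1 ?addr0; last first.
  move=> i ii0; have [r' er' hr'] := row i.
  have [eqr|neqr] := eqVneq r r'; last by rewrite hr' ?scaler0.
  have /holds_bigand/(_ i0 ii0) := hP i isT; case.
  exact/(par_row er' hr' er hr).
by move/eqP; rewrite scaler_eq0 (negPf ci0) (negPf er).
Qed.

Lemma row_structure_TK (y : Y) : y != 0 -> model (TK K) M.
Proof.
move=> y0 f; case.
- by move=> e x y' z /=; apply: functional_extensionality => k; rewrite /= addrA.
- by move=> e x z /=; apply: functional_extensionality => k; rewrite /= addrC.
- by move=> e x /=; apply: functional_extensionality => k; rewrite /= add0r.
- move=> e x; exists (fun k => - x k) => /=.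
  by apply: functional_extensionality => k; rewrite /= subrr.
- by move=> a b e x; apply: functional_extensionality => k; rewrite /= scalerA.
- by move=> e x; apply: functional_extensionality => k; rewrite /= scale1r.
- by move=> a e x z; apply: functional_extensionality => k; rewrite /= scalerDr.
- by move=> a b e x; apply: functional_extensionality => k; rewrite /= scalerDl.
- move=> a e x [s ss h]; exists s => // k ks /=.
  by have /= -> := h k ks; rewrite scaler0.
- by move=> n e; apply: holds_X_sum.
- move=> e x [[s ss h] _]; exists s => // k ks /=.
  by have /= -> := h k ks; rewrite addr0.
- move=> e x z _ [s ss h]; exists s => // k ks /=.
  by have /= := h k ks; rewrite addrC.
- move=> e x z w [[X1 X1n] [[X2 X2n] [X3 X3n]]].
  have [r1 u1 h1] := X0_row X1 X1n.
  have [r2 u2 h2] := X0_row X2 X2n.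
  have [r3 u3 h3] := X0_row X3 X3n.
  move=> /(par_row u1 h1 u2 h2) e12 /(par_row u2 h2 u3 h3) e23.
  by apply/(par_row u1 h1 u3 h3); rewrite e12.
- by move=> n e; apply: holds_axes_infinite y0.
- by move=> n e; apply: holds_foldr_FAll => e'; apply: holds_axes_indep.
Qed.

(** X^0 = {0}, so equations are instances of X^0. *)
Lemma eval_eq_X0 e (t u : term K) :
  eval e t = eval e u <-> s_X 0 (eval e (TAdd t (TScale (-1) u))).
Proof.
split=> [/= ->|[[|//] _ h]].
  by exists [::] => // k _ /=; rewrite scaleN1r subrr.
apply: functional_extensionality => k.
by apply/eqP; rewrite -subr_eq0 -scaleN1r; apply/eqP/h.
Qed.

End RowStructure.

Lemma row_qf_agree (K : finFieldType) (Y Z : lmodType K)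
    (e : nat -> row_structure Y) (e' : nat -> row_structure Z) :
  (forall n t, s_X n (eval e t) <-> s_X n (eval e' t)) ->
  forall f, quantifier_free f -> (holds e f <-> holds e' f).
Proof.
by move=> hX; apply: qf_agree => // t u; rewrite !eval_eq_X0.
Qed.

(** * One-dimensional and infinite-dimensional axes *)

(** The monomials 1, t, ..., t^(n-1) placed at the row of the given vector are
    independent elements of its axis. *)
Lemma row_poly_axis_dim (K : finFieldType) n
    (e : nat -> row_structure {poly K}) : holds e (FAxisDim K n).
Proof.
move=> x [] /=; rewrite /upd eqxx => X1 X1n.
have [r xr hr] := X0_row X1 X1n.
apply/holds_foldr_FEx.
pose b i : row_structure {poly K} := fun k => if k == r then 'X^i else 0.
have br i : b i r != 0 by rewrite /b eqxx monic_neq0 ?monicXn.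
have hb i : on_row r (b i) by move=> k /negPf kr; rewrite /b kr.
exists b; split.
  apply/holds_bigand => i _ /=; rewrite !mem_iota /= !add0n ltn_ord ltnn eqxx.
  right; split; last exact/(par_row (br i) (hb i) xr hr).
  split; first by apply/X1P; exists r.
  by move=> h; have := br i; rewrite h eqxx.
apply/holds_bigand => c /existsP[i0 ci0] /= sum0.
have := congr1 (fun v : row_structure {poly K} => (v r)`_i0) sum0.
rewrite eval_bigadd coef0 coef_sum (bigD1 i0) //= big1 ?addr0 => [|i ii0].
  rewrite mem_iota /= add0n ltn_ord /b eqxx coefZ coefXn eqxx mulr1.
  by move/eqP; rewrite (negPf ci0).
rewrite mem_iota /= add0n ltn_ord /b eqxx coefZ coefXn.
by rewrite eq_sym (inj_eq val_inj) (negPf ii0) mulr0.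
Qed.

Lemma row_poly_TK (K : finFieldType) : model (TK K) (row_structure {poly K}).
Proof. exact: row_structure_TK (oner_neq0 {poly K}). Qed.

Lemma row_poly_TKinf (K : finFieldType) :
  model (TKinf K) (row_structure {poly K}).
Proof.
move=> f [/row_poly_TK//|[n ->]] e; exact: row_poly_axis_dim.
Qed.

Lemma row_line_TK (K : finFieldType) : model (TK K) (row_structure K^o).
Proof. exact: (@row_structure_TK K K^o 1 (oner_neq0 K)). Qed.

(** Two scalars a, b always satisfy the relation b a - a b = 0, which is
    nontrivial unless a = 0; in that case 1 a + 0 b = 0 is. *)
Lemma row_line_axis_dim (K : finFieldType) (e : nat -> row_structure K^o) :
  ~ holds e (FAxisDim K 2).
Proof.
pose x : row_structure K^o := fun k => if k == 0%N then 1 else 0.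
have xr : x 0%N != 0 by rewrite /x /= oner_neq0.
have hx : on_row 0%N x by move=> k /negPf k0; rewrite /x k0.
move=> /(_ x)[].
  split; first by apply/X1P; exists 0%N.
  by move=> h; have := xr; rewrite [x]h eqxx.
move=> u [v [/holds_bigand ax /holds_bigand indep]].
have row0 w : w = s_zero _ \/ ((s_X 1 w /\ w <> s_zero _) /\ s_X 1 (s_add w x)) ->
    on_row 0%N w.
  case=> [-> //|[[w1 w2]]]; have [r wr hr] := X0_row w1 w2.
  by move=> /(par_row wr hr xr hx) <-.
have hu : on_row 0%N u by have /= := ax ord0 isT => /row0.
have hv : on_row 0%N v by have /= := ax ord_max isT => /row0.
have no_rel (a b : K) : (a != 0) || (b != 0) ->
    a *: (u 0%N) + b *: (v 0%N) <> 0.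
  move=> ab0 rel.
  apply: (indep [ffun i : 'I_2 => if i == ord0 then a else b]).
    case/orP: ab0 => h; apply/existsP; [exists ord0 | exists ord_max];
    by rewrite ffunE.
  apply: functional_extensionality => k.
  rewrite eval_bigadd !big_ord_recl big_ord0 addr0 /= !ffunE /=.
  have [->|k0] := eqVneq k 0%N; first exact: rel.
  by rewrite [upd _ _ _ _ _]hu // [upd _ _ _ _ _]hv // !scaler0 addr0.
have [u0|u0] := eqVneq (u 0%N) 0.
  by apply: (no_rel 1 0); rewrite ?oner_neq0 // u0 scaler0 scale0r addr0.
apply: (no_rel (v 0%N) (- u 0%N)); first by rewrite oppr_eq0 u0 orbT.
by rewrite scaleNr /GRing.scale /= mulrC subrr.
Qed.

Lemma TK_incomplete (K : finFieldType) : ~ complete (TK K).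
Proof.
move=> /(_ _ (sentence_FAxisDim K 2))[] h.
  exact: row_line_axis_dim (h _ (@row_line_TK K) (fun=> s_zero _)).
apply: (h _ (@row_poly_TK K) (fun=> s_zero _)).
exact: row_poly_axis_dim.
Qed.

Lemma TK_no_elimination (K : finFieldType) : ~ eliminates_quantifiers (TK K).
Proof.
have eval0 (Y : lmodType K) t :
    eval (fun=> s_zero (row_structure Y)) t = s_zero (row_structure Y).
  elim: t => //= [t -> u ->|a t ->]; apply: functional_extensionality => k /=.
    exact: addr0.
  exact: scaler0.
apply: (@not_eliminates_quantifiers _ _ _ _ (fun=> s_zero _) (fun=> s_zero _)
  (FAxisDim K 2) (@row_poly_TK K) (@row_line_TK K)).
- apply: row_qf_agree => n t; rewrite !eval0.
  by split=> _; exists [::].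
- exact: row_poly_axis_dim.
- exact: row_line_axis_dim.
Qed.

(** * Two pairs with the same weights *)

Section Weights.
Variables (K : finFieldType) (J : finType).
Local Notation M := (row_structure {poly K}).

(** The sequence taking the values of f at the rows coding the elements of J. *)
Definition row_ext (f : J -> {poly K}) : M :=
  fun k => if pickle_inv k is Some j then f j else 0.

Lemma row_ext_pickle f j : row_ext f (pickle j) = f j.
Proof. by rewrite /row_ext pickleK_inv. Qed.

Lemma X_row_ext n f (S : {set J}) : (forall j, (j \in S) = (f j != 0)) ->
  s_X n (row_ext f) <-> (#|S| <= n)%N.
Proof.
move=> hS; split=> [|Sn].
  move=> /(@X_ge_size _ _ _ _ [seq pickle j | j <- enum S]).
  rewrite size_map -cardE; apply.
    by rewrite map_inj_uniq ?enum_uniq //; apply: pcan_inj pickleK.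
  by move=> k /mapP[j]; rewrite mem_enum hS => jS ->; rewrite row_ext_pickle.
exists [seq pickle j | j <- enum S]; first by rewrite size_map -cardE.
move=> k; rewrite /row_ext.
case E: (pickle_inv k) => [j|//]; have := @pickle_invK J k; rewrite E /= => <-.
apply: contraNeq => fj; apply: map_f.
by rewrite mem_enum hS.
Qed.

End Weights.

Section Pairs.
Variable K : finFieldType.
Local Notation M := (row_structure {poly K}).
Local Notation q := #|K|.
Implicit Types (f g : option K -> {poly K}).

Definition pair_env f g : nat -> M :=
  fun m => if m == 0%N then row_ext f else row_ext g.

(** The coefficients l and m depend on the term only, so atomic formulas can be
    compared between different pairs. *)
Lemma eval_pair_env t : exists l m : K, forall f g,
  eval (pair_env f g) t = row_ext (fun j => l *: f j + m *: g j).
Proof.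
have ext0 : s_zero M = row_ext (fun _ : option K => 0).
  by apply: functional_extensionality => k; rewrite /row_ext; case: pickle_inv.
elim: t => [n||t [l [m ht]] u [l' [m' hu]]|a t [l [m ht]]].
- case: n => [|n]; [exists 1, 0|exists 0, 1] => f g /=; congr row_ext;
    apply: functional_extensionality => j; rewrite scale0r scale1r.
    by rewrite addr0.
  by rewrite add0r.
- exists 0, 0 => f g; rewrite [LHS]ext0; congr row_ext.
  by apply: functional_extensionality => j; rewrite !scale0r addr0.
- exists (l + l'), (m + m') => f g /=; rewrite ht hu.
  apply: functional_extensionality => k; rewrite /= /row_ext.
  case: pickle_inv => [j|]; last exact: addr0.
  by rewrite !scalerDl addrACA.
- exists (a * l), (a * m) => f g /=; rewrite ht.
  apply: functional_extensionality => k; rewrite /= /row_ext.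
  case: pickle_inv => [j|]; last exact: scaler0.
  by rewrite scalerDr !scalerA.
Qed.

(** [None] is the point at infinity of the projective line over K. The pair
    [pt_fst], [pt_snd] lists homogeneous coordinates of its points; in the pair
    [pt_fst], [gen_snd] the two vectors are independent at every finite row. *)
Definition pt_fst (j : option K) : {poly K} := if j is Some _ then 1 else 0.
Definition pt_snd (j : option K) : {poly K} := if j is Some c then c%:P else 1.
Definition gen_snd (j : option K) : {poly K} := if j is Some _ then 'X else 0.

Lemma card_but_one (j0 : option K) : #|[set~ j0]| = q.
Proof. by rewrite cardsC1 card_option. Qed.

Definition misses_one_row f g := forall l m : K, (l != 0) || (m != 0) ->
  exists j0, forall j, (l *: f j + m *: g j != 0) = (j != j0).

(** The zero of the linear form (l, m) is the point at infinity if m = 0, and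
    the finite point - l / m otherwise. *)
Lemma pt_misses_one_row : misses_one_row pt_fst pt_snd.
Proof.
move=> l m lm0; have [m0|m0] := eqVneq m 0.
  exists None => -[c|] /=; rewrite m0 scale0r addr0 ?scaler0 ?eqxx //.
  rewrite scaler_eq0 oner_eq0 orbF; move: lm0; rewrite m0 eqxx orbF.
  by move->.
exists (Some (- l / m)) => -[c|] /=; last first.
  by rewrite scaler0 add0r scaler_eq0 negb_or m0 oner_neq0.
rewrite -!mul_polyC mulr1 -polyCM -polyCD polyC_eq0 addrC addr_eq0.
have -> : (Some c == Some (- l / m)) = (c == - l / m) by [].
by rewrite -[in RHS](inj_eq (@mulIf _ m m0)) divfK // mulrC.
Qed.

Lemma gen_misses_one_row : misses_one_row pt_fst gen_snd.
Proof.
move=> l m lm0; exists None => -[c|] /=; last by rewrite !scaler0 addr0 eqxx.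
apply/eqP => h; have [m0|m0] := eqVneq m 0.
  have /eqP := congr1 (fun p : {poly K} => p`_0) h.
  rewrite coefD !coefZ coef1 coefX coef0 mulr0 addr0 mulr1.
  by move: lm0; rewrite m0 eqxx orbF => /negPf ->.
have /eqP := congr1 (fun p : {poly K} => p`_1) h.
by rewrite coefD !coefZ coef1 coefX coef0 mulr0 add0r mulr1 (negPf m0).
Qed.

Lemma X_misses_one_row f g n (l m : K) : misses_one_row f g ->
  s_X n (row_ext (fun j => l *: f j + m *: g j)) <->
  ((l == 0) && (m == 0)) || (q <= n)%N.
Proof.
move=> fg; have [/andP[/eqP -> /eqP ->]|] := boolP ((l == 0) && (m == 0)).
  by split=> // _; exists [::] => // k _; rewrite /row_ext; case: pickle_inv
    => // j; rewrite !scale0r addr0.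
rewrite negb_and => /fg[j0 hj0] /=.
rewrite -(card_but_one j0); apply: X_row_ext => j.
by rewrite hj0 !inE.
Qed.

Lemma pairs_qf_agree (f : formula K) : quantifier_free f ->
  (holds (pair_env pt_fst pt_snd) f <-> holds (pair_env pt_fst gen_snd) f).
Proof.
apply: row_qf_agree => n t; have [l [m h]] := eval_pair_env t.
rewrite !h !X_misses_one_row //; [exact: gen_misses_one_row|exact: pt_misses_one_row].
Qed.

(** Some x in X lies along a common part with v_0, since subtracting it lowers
    the weight of v_0, but is disjoint from v_1, since subtracting it raises the
    weight of v_1; here both v_0 and v_1 have weight q. *)
Definition FPeel : formula K :=
  FEx 2 (FAnd (FX 1 (TVar 2))
    (FAnd (FX q.-1 (TAdd (TVar 0) (TScale (-1) (TVar 2))))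
          (FNot (FX q (TAdd (TVar 1) (TScale (-1) (TVar 2))))))).

(** The witness is 1 at the row of the finite point 0, where the first vector is
    1 and the second is 0. *)
Lemma pt_FPeel : holds (pair_env pt_fst pt_snd) FPeel.
Proof.
pose d (j : option K) : {poly K} := if j == Some 0 then 1 else 0.
have sub_ext f : s_add (row_ext f) (s_scale (-1) (row_ext d)) =
    row_ext (fun j => f j - d j).
  apply: functional_extensionality => k; rewrite /= /row_ext.
  case: pickle_inv => [j|]; first by rewrite scaleN1r.
  by rewrite scaler0 addr0.
exists (row_ext d); split; [|split].
- apply/(@X_row_ext _ _ _ _ [set Some 0]); last by rewrite cards1.
  by move=> j; rewrite inE /d; case: eqP; rewrite ?oner_neq0 ?eqxx.
- rewrite -[holds _ _]/(s_X q.-1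
    (s_add (row_ext pt_fst) (s_scale (-1) (row_ext d)))).
  rewrite sub_ext; apply/(@X_row_ext _ _ _ _ (~: [set None; Some 0])).
    move=> [c|]; rewrite !inE /d /= ?subr0 ?eqxx //.
    by case: (Some c == _); rewrite ?subrr ?eqxx // subr0 oner_neq0.
  by rewrite cardsCs setCK cards2 card_option subSS subn1.
- rewrite -[holds _ _]/(~ s_X q
    (s_add (row_ext pt_snd) (s_scale (-1) (row_ext d)))).
  rewrite sub_ext (@X_row_ext _ _ _ _ setT) ?cardsT ?card_option ?ltnn // => j.
  rewrite inE /d; case: (j =P Some 0) => [-> /=|]; first by rewrite sub0r oppr_eq0 oner_eq0.
  rewrite subr0; case: j => [c|] /=; last by rewrite oner_eq0.
  by rewrite polyC_eq0 => c0; apply/esym/eqP => c00; apply: c0; rewrite c00.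
Qed.

(** If x sits at a finite row, then b - x stays supported on the q finite rows;
    otherwise a - x keeps the q nonzero finite rows of a. *)
Lemma gen_FPeel : ~ holds (pair_env pt_fst gen_snd) FPeel.
Proof.
move=> [x [/X1P[r hr] [Xa Xb]]].
pose T := [seq pickle j | j <- enum [set~ (None : option K)]].
have sizeT : size T = q by rewrite size_map -cardE card_but_one.
have memT k : k \in T -> exists c, k = pickle (Some c : option K).
  by move=> /mapP[[c|]]; rewrite mem_enum !inE // => _ ->; exists c.
have [rT|rT] := boolP (r \in T).
  apply: Xb; exists T; first by rewrite sizeT.
  move=> k kT; have kr : k != r by apply: contraNneq kT => ->.
  have /= := hr k kr; rewrite /upd /= => ->; rewrite scaler0 addr0.
  rewrite /pair_env /= /row_ext.
  case E: (pickle_inv k) => [[c|]|] //.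
  have := @pickle_invK (option K) k; rewrite E /=.
  move=> ek; case/negP: kT; rewrite -ek; apply: map_f.
  by rewrite mem_enum !inE.
have q_gt0 : (0 < q)%N by apply/card_gt0P; exists 0.
suff : (size T <= q.-1)%N by rewrite sizeT -ltnS prednK // ltnn.
apply: X_ge_size Xa.
  by rewrite map_inj_uniq ?enum_uniq //; apply: pcan_inj pickleK.
move=> k kT; have kr : k != r by apply: contraNneq rT => <-.
have /= := hr k kr; rewrite /upd /= => ->; rewrite scaler0 addr0.
have [c ->] := memT k kT.
by rewrite /pair_env /= row_ext_pickle oner_neq0.
Qed.

End Pairs.

Theorem mainTheorem4 (K : finFieldType) :
  [/\ ~ complete (TK K),
      ~ eliminates_quantifiers (TK K)
    & ~ eliminates_quantifiers (TKinf K)].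
Proof.
split; [exact: TK_incomplete | exact: TK_no_elimination |].
apply: (@not_eliminates_quantifiers _ _ _ _ (pair_env (@pt_fst K) (@pt_snd K))
  (pair_env (@pt_fst K) (@gen_snd K)) (FPeel K)
  (@row_poly_TKinf K) (@row_poly_TKinf K)).
- exact: pairs_qf_agree.
- exact: pt_FPeel.
- exact: gen_FPeel.
Qed.
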